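(* Let $\mathfrak C$ be a left cancellative small category. (i) $I_l\ltimes\Omega$ is Hausdorff if and only if for all $s\in I_l$ there exists a (possibly empty) finite subset $\{e_1,\dots,e_n\}\subseteq\mathcal J$ with $\{x\in\mathrm{dom}(s):s(x)=x\}=\bigcup_{i=1}^ne_i$. (ii) $I_l\,\bar\ltimes\,\Omega$ is Hausdorff if and only if for all $s\in I_l$ there exists a (possibly empty) finite subset $\{\varepsilon_1,\dots,\varepsilon_n\}\subseteq\bar{\mathcal J}$ with $\{x\in\mathrm{dom}(s):s(x)=x\}=\bigcup_{i=1}^n\varepsilon_i$.
   Context: $\mathfrak C$ denotes the set of morphisms, $\mathfrak C^0\subseteq\mathfrak C$ the identity morphisms, $\mathfrak d,\mathfrak t$ domain and target; $cd$ is defined iff $\mathfrak d(c)=\mathfrak t(d)$; left cancellative means $cx=cy\Rightarrow x=y$. Each $c\in\mathfrak C$ gives the partial bijection $\mathfrak d(c)\mathfrak C\to c\mathfrak C$, $x\mapsto cx$; $I_l$ is the smallest semigroup of partial bijections of $\mathfrak C$ containing these and closed under inverses; $\mathcal J=\{\mathrm{dom}(s):s\in I_l\}$ is its semilattice of idempotents (product = intersection). $\bar{\mathcal J}$ is the set of subsets $\varepsilon=e\setminus\bigcup_{i=1}^nf_i$ of $\mathfrak C$ with $e,f_1,\dots,f_n\in\mathcal J$, $f_i\subseteq e$. $\widehat{\mathcal J}$ is the space of non-zero multiplicative maps $\chi:\mathcal J\to\{0,1\}$ with $\chi(\emptyset)=0$ if $\emptyset\in\mathcal J$ (pointwise convergence).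 $\Omega\subseteq\widehat{\mathcal J}$ consists of those $\chi$ such that whenever $e=\bigcup_{i=1}^nf_i$ ($e,f_i\in\mathcal J$) and $\chi(e)=1$, then $\chi(f_i)=1$ for some $i$. For $\chi\in\Omega$ and $\varepsilon=e\setminus\bigcup f_i\in\bar{\mathcal J}$, put $\chi(\varepsilon)=1$ iff $\chi(e)=1$ and $\chi(f_i)=0$ for all $i$, and $\chi(\varepsilon)=0$ otherwise (well defined). $s\in I_l$ acts by $\chi\mapsto s.\chi=\chi(s^{-1}\cdot s)$ from $\Omega(s^{-1}s)=\{\chi\in\Omega:\chi(s^{-1}s)=1\}$ onto $\Omega(ss^{-1})$. $I_l\ltimes\Omega$ is the quotient of $\{(s,\chi)\in I_l\times\Omega:\chi(s^{-1}s)=1\}$ by $(s,\chi)\sim(t,\psi)$ iff $\chi=\psi$ and $se=te$ for some $e\in\mathcal J$ with $\chi(e)=1$; $I_l\,\bar\ltimes\,\Omega$ is the quotient by $(s,\chi)\bar\sim(t,\psi)$ iff $\chi=\psi$ and $s\varepsilon=t\varepsilon$ for some $\varepsilon\in\bar{\mathcal J}$ with $\chi(\varepsilon)=1$ (here $se$, $s\varepsilon$ denote restrictions as partial bijections). Both are groupoids with source $\chi$, range $s.\chi$, $[s,t.\chi][t,\chi]=[st,\chi]$, $[s,\chi]^{-1}=[s^{-1},s.\chi]$; in both cases the topology is such that the images of $\{s\}\times\Omega(s^{-1}s)$ are open and mapped homeomorphically onto $\Omega(s^{-1}s)$ by the source map. *)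

(* Defs.v *)
From HB Require Import structures.
From mathcomp Require Import all_boot.
From mathcomp Require Import all_classical.
From mathcomp Require Import topology.

Set Implicit Arguments.
Unset Strict Implicit.
Unset Printing Implicit Defensive.

Local Open Scope classical_set_scope.

(* A small category is given by its set of morphisms; an object is identified
   with its identity morphism, so that [src] and [tgt] are maps from morphisms
   to morphisms.  [cmp c d] is the composite "d first, then c"; its value is
   meaningful only when [src c = tgt d], and no axiom constrains it otherwise. *)
Record smallCategory := SmallCategory {
  mor :> Type;
  src : mor -> mor;
  tgt : mor -> mor;
  cmp : mor -> mor -> mor;
  src_src : forall c, src (src c) = src c;
  tgt_src : forall c, tgt (src c) = src c;
  src_tgt : forall c, src (tgt c) = tgt c;
  tgt_tgt : forall c, tgt (tgt c) = tgt c;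
  src_cmp : forall c d, src c = tgt d -> src (cmp c d) = src d;
  tgt_cmp : forall c d, src c = tgt d -> tgt (cmp c d) = tgt c;
  cmpA : forall b c d, src b = tgt c -> src c = tgt d ->
    cmp b (cmp c d) = cmp (cmp b c) d;
  cmp_src : forall c, cmp c (src c) = c;
  cmp_tgt : forall c, cmp (tgt c) c = c
}.

Definition left_cancellative (C : smallCategory) :=
  forall c x y : C, src c = tgt x -> src c = tgt y ->
    cmp c x = cmp c y -> x = y.

Record lcCategory := LcCategory {
  lc_category :> smallCategory;
  lc_cancel : left_cancellative lc_category
}.

(* Partial maps are represented by their graphs. *)
Section PartialMaps.
Variable T : Type.
Implicit Types (s t : set (T * T)) (e : set T).

Definition partial_bijection s :=
  (forall x y z, s (x, y) -> s (x, z) -> y = z) /\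
  (forall x y z, s (x, z) -> s (y, z) -> x = y).

Definition pdom s : set T := [set x | exists y, s (x, y)].

(* [pcomp s t] is s \o t: first t, then s. *)
Definition pcomp s t : set (T * T) := [set p | exists2 y, t (p.1, y) & s (y, p.2)].

Definition pinv s : set (T * T) := [set p | s (p.2, p.1)].

Definition prestr s e : set (T * T) := [set p | s p /\ e p.1].

Definition pfix s : set T := [set x | s (x, x)].

End PartialMaps.

Section LeftCategory.
Variable C : lcCategory.

(* x |-> cx, with domain src(c)C = {x | tgt x = src c} *)
Definition lmul (c : C) : set (C * C) :=
  [set (x, cmp c x) | x in [set x | src c = tgt x]].

Inductive left_inverse_hull : set (C * C) -> Prop :=
| lih_gen c : left_inverse_hull (lmul c)
| lih_comp s t : left_inverse_hull s -> left_inverse_hull t ->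
    left_inverse_hull (pcomp s t)
| lih_inv s : left_inverse_hull s -> left_inverse_hull (pinv s).

Definition Il : set (set (C * C)) := left_inverse_hull.

Lemma Il_partial_bijection (s : set (C * C)) : Il s -> partial_bijection s.
Proof.
elim=> {s} [c|s t _ [sf si] _ [tf ti]|s _ [sf si]]; split.
- by move=> x y z [a _ [<- <-]] [b _ [<- <-]].
- move=> x y z [a /= ha [<- <-]] [b /= hb [<-]].
  by move/esym; apply: lc_cancel.
- move=> x y z [a /= h1 h2] [b /= h3 h4].
  by move: (tf _ _ _ h1 h3) h2 => -> h2; exact: sf h2 h4.
- move=> x y z [a /= h1 h2] [b /= h3 h4].
  by move: (si _ _ _ h2 h4) h1 => -> h1; exact: ti h1 h3.
- by move=> x y z /= h1 h2; exact: si h1 h2.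
- by move=> x y z /= h1 h2; exact: sf h1 h2.
Qed.

Definition J : set (set C) := [set pdom s | s in Il].

Lemma JI (e f : set C) : J e -> J f -> J (e `&` f).
Proof.
move=> [s hs <-] [t ht <-].
have [sf si] := Il_partial_bijection hs; have [tf ti] := Il_partial_bijection ht.
exists (pcomp (pcomp (pinv s) s) (pcomp (pinv t) t)).
  by do 2![apply: lih_comp => //; try exact: lih_inv];
    apply: lih_comp => //; exact: lih_inv.
apply/seteqP; split=> x /=.
  move=> [y [z /= [a /= h1 h2] [b /= h3 h4]]].
  by split; [exists b; rewrite (ti _ _ _ h1 h2)|exists a].
move=> [[a ha] [b hb]]; exists x; exists x; first by exists b.
by exists a.
Qed.

Definition Jmeet (e f : J) : J :=
  exist _ (\val e `&` \val f) (mem_set (JI (set_valP e) (set_valP f))).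

(* dom(s), i.e. the idempotent s^-1 s, as an element of J *)
Definition Jdom (s : Il) : J :=
  exist _ (pdom (\val s))
    (mem_set (ex_intro2 _ _ (\val s) (set_valP s) erefl : J (pdom (\val s)))).

(* The topology of [{ptws J -> bool}] is that of pointwise convergence. *)
Definition Jhat : set {ptws J -> bool} :=
  [set chi | [/\ exists e, chi e = true,
                 forall e f, chi (Jmeet e f) = chi e && chi f
               & forall e, \val e = set0 -> chi e = false]].

Definition Omega : set {ptws J -> bool} :=
  [set chi | Jhat chi /\
    forall (e : J) (F : set J), finite_set F ->
      \val e = \bigcup_(f in F) \val f ->
      chi e = true -> exists2 f, F f & chi f = true].

(* (e, F) presents eps as the difference of e and a finite union of f <= e. *)
Definition presents (e : J) (F : set J) (eps : set C) :=
  [/\ finite_set F, forall f, F f -> \val f `<=` \val e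
    & eps = \val e `\` \bigcup_(f in F) \val f].

Definition Jbar : set (set C) :=
  [set eps | exists e F, presents e F eps].

Definition eval_presented (chi : Omega) (e : J) (F : set J) :=
  \val chi e = true /\ forall f, F f -> \val chi f = false.

(* The sets eps in J, resp. in Jbar, such that chi(eps) = 1.  That chi(eps)
   does not depend on the presentation is [eval_presented_indep]. *)
Definition supp (chi : Omega) : set (set C) :=
  [set \val e | e in [set e : J | \val chi e = true]].

Definition supp_bar (chi : Omega) : set (set C) :=
  [set eps | exists e F, presents e F eps /\ eval_presented chi e F].

Lemma OmegaI (chi : Omega) (e f : J) :
  \val chi (Jmeet e f) = \val chi e && \val chi f.
Proof. by have [[_ mul _] _] := set_valP chi; exact: mul. Qed.

Lemma eval_presented_indep (chi : Omega) (eps : set C) (e e' : J) (F F' : set J) :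
  presents e F eps -> presents e' F' eps ->
  eval_presented chi e F -> eval_presented chi e' F'.
Proof.
move=> [finF Fe epsE] [finF' Fe' epsE'] [chie chiF].
have [_ cov] := set_valP chi.
have tI (a b : J) : \val chi a = true -> \val chi b = true ->
    \val chi (Jmeet a b) = true by move=> ha hb; rewrite OmegaI ha hb.
have tl (a b : J) : \val chi (Jmeet a b) = true ->
    \val chi a = true /\ \val chi b = true.
  by rewrite OmegaI => /andP[-> ->].
have noF (a : J) : \val a `<=` \bigcup_(f in F) \val f -> \val a `<=` \val e ->
    \val chi a = true -> False.
  move=> aF _ chia.
  have [||_ [f Ff <-]] := cov a [set Jmeet a f | f in F] _ _ chia.
  - exact: finite_image.
  - apply/seteqP; split=> x.
      by move=> ax; have [f Ff fx] := aF _ ax; exists (Jmeet a f) => //; exists f.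
    by move=> [_ [f Ff <-]] [].
  - by move=> /tl [_]; rewrite chiF.
have chie' : \val chi e' = true.
  have [||f [->|[g Fg <-]]] := cov e (Jmeet e e' |` [set f | f in F]) _ _ chie.
  - by rewrite finite_setU; split; [exact: finite_set1|exact: finite_image].
  - apply/seteqP; split=> x; last first.
      by move=> [_ [->|[f Ff <-]]]; [move=> []|move/(Fe _ Ff)].
    move=> ex; have [[f Ff fx]|nx] := pselect ((\bigcup_(f in F) \val f) x).
      by exists f => //; right; exists f.
    exists (Jmeet e e'); first by left.
    split=> //; have : eps x by rewrite epsE.
    by rewrite epsE' => -[].
  - by move=> /tl[].
  - by rewrite chiF.
split=> // f F'f; apply/negbTE/negP => chif.
apply: (noF (Jmeet e f)); last exact: tI.
  move=> x [ex fx]; apply: contrapT => nx.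
  have : eps x by rewrite epsE.
  by rewrite epsE' => -[_]; apply; exists f.
by move=> x [].
Qed.

Lemma supp_dom (chi : Omega) (e : J) : \val chi e = true -> supp chi (\val e).
Proof. by move=> h; exists e. Qed.

Lemma supp_bar_dom (chi : Omega) (e : J) :
  \val chi e = true -> supp_bar chi (\val e).
Proof.
move=> h; exists e, set0; split; last by split.
by split=> //; rewrite bigcup_set0 setD0.
Qed.

Lemma suppI (chi : Omega) (a b : set C) :
  supp chi a -> supp chi b -> supp chi (a `&` b).
Proof.
move=> [e he <-] [f hf <-]; exists (Jmeet e f) => //.
by move: he hf; rewrite /mkset OmegaI => -> ->.
Qed.

Lemma supp_barI (chi : Omega) (a b : set C) :
  supp_bar chi a -> supp_bar chi b -> supp_bar chi (a `&` b).
Proof.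
move=> [e [F [[finF Fe ->] [he hF]]]] [e' [F' [[finF' Fe' ->] [he' hF']]]].
exists (Jmeet e e'), ([set Jmeet f e' | f in F] `|` [set Jmeet f e | f in F']).
split; split.
- by rewrite finite_setU; split; exact: finite_image.
- by move=> _ [[f /Fe fe <-]|[f /Fe' fe <-]] x [/fe].
- apply/seteqP; split=> x.
    move=> [[ex nx] [e'x nx']]; split=> // -[_ [[f Ff <-]|[f Ff <-]] [fx _]].
      by apply: nx; exists f.
    by apply: nx'; exists f.
  move=> [[ex e'x] nx]; split; split=> // -[f Ff fx]; apply: nx.
    by exists (Jmeet f e') => //; left; exists f.
  by exists (Jmeet f e) => //; right; exists f.
- by rewrite OmegaI he he'.
- by move=> _ [[f /hF hf <-]|[f /hF' hf <-]]; rewrite OmegaI hf.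
Qed.

Lemma eval_continuous (e : J) : continuous (fun chi : Omega => \val chi e).
Proof.
move=> chi; apply: (@continuous_comp Omega {ptws J -> bool} bool \val
  (fun f : {ptws J -> bool} => f e)).
  exact: initial_continuous.
exact: (@proj_continuous J (fun=> bool) e).
Qed.

Lemma open_eval (e : J) (b : bool) : open [set chi : Omega | \val chi e = b].
Proof.
have -> : [set chi : Omega | \val chi e = b] =
  (fun chi : Omega => \val chi e) @^-1` [set b] by [].
apply: open_comp => [x _|]; first exact: eval_continuous.
exact: discrete_open.
Qed.

Lemma supp_open (eps : set C) : open [set chi | supp chi eps].
Proof.
have -> : [set chi | supp chi eps] =
  \bigcup_(e in [set e : J | \val e = eps]) [set chi : Omega | \val chi e = true].
  by apply/seteqP; split=> chi [e h1 h2]; exists e.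
by apply: bigcup_open => e _; exact: open_eval.
Qed.

Lemma supp_bar_open (eps : set C) : open [set chi | supp_bar chi eps].
Proof.
have -> : [set chi | supp_bar chi eps] =
  \bigcup_(p in [set p : J * set J | presents p.1 p.2 eps])
    ([set chi : Omega | \val chi p.1 = true] `&`
     ~` \bigcup_(f in p.2) [set chi : Omega | \val chi f = true]).
  apply/seteqP; split=> chi.
    move=> [e [F [h1 [h2 h3]]]]; exists (e, F) => //; split=> //= -[f Ff].
    by rewrite /= h3.
  move=> [[e F] h1 [h2 /= h3]]; exists e, F; split=> //; split=> // f Ff.
  by apply/negbTE/negP => chif; apply: h3; exists f.
apply: bigcup_open => -[e F] [/= finF _ _]; apply: openI; first exact: open_eval.
apply/closed_openC/closed_bigcup => // f _.
have -> : [set chi : Omega | \val chi f = true] =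
    ~` [set chi : Omega | \val chi f = false].
  by apply/seteqP; split=> chi /=; case: (\val chi f).
exact/open_closedC/open_eval.
Qed.

End LeftCategory.

Arguments Il : clear implicits.
Arguments J : clear implicits.
Arguments Jbar : clear implicits.
Arguments Omega : clear implicits.

(* The two transformation groupoids differ only in the sets on which two
   partial bijections must agree in order to define the same germ at chi. *)
Record germ_supports (C : lcCategory) := GermSupports {
  gs_set :> Omega C -> set (set C);
  gs_dom : forall chi e, \val chi e = true -> gs_set chi (\val e);
  gs_I : forall chi a b, gs_set chi a -> gs_set chi b -> gs_set chi (a `&` b);
  gs_open : forall eps, open [set chi | gs_set chi eps]
}.

Section Germs.
Variables (C : lcCategory) (P : germ_supports C).

(* Omega(s^-1 s) *)
Definition OmegaDom (s : Il C) : topologicalType :=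
  [set chi : Omega C | \val chi (Jdom s) = true].

(* The pairs (s, chi) with chi in Omega(s^-1 s), with Il discrete *)
Definition germ_pair : topologicalType := {s : Il C & OmegaDom s}.

Definition pair_src (p : germ_pair) : Omega C := \val (projT2 p).

Definition germ_eq (p q : germ_pair) : Prop :=
  pair_src p = pair_src q /\
  exists2 eps, P (pair_src p) eps &
    prestr (\val (projT1 p)) eps = prestr (\val (projT1 q)) eps.

Definition germ_eqb : rel germ_pair := fun p q => `[< germ_eq p q >].

Lemma germ_eqb_refl : reflexive germ_eqb.
Proof.
move=> [s chi]; apply/asboolP; split=> //.
by exists (\val (Jdom s)) => //; apply: gs_dom; exact: (set_valP chi).
Qed.

Lemma germ_eqb_sym : symmetric germ_eqb.
Proof.
suff H p q : germ_eqb p q -> germ_eqb q p by move=> p q; apply/idP/idP; exact: H.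
move=> /asboolP[pq [eps h1 h2]]; apply/asboolP.
by split=> //; exists eps => //; rewrite -pq.
Qed.

Lemma germ_eqb_trans : transitive germ_eqb.
Proof.
move=> q p r /asboolP[pq [a Pa sa]] /asboolP[qr [b Pb sb]]; apply/asboolP.
split; first by rewrite pq.
exists (a `&` b); first by apply: gs_I => //; rewrite pq.
have H (T : Type) (s : set (T * T)) u v :
    prestr s (u `&` v) = prestr (prestr s u) v.
  by apply/seteqP; split=> x; [move=> [? []]|move=> [[]]].
by rewrite H sa -H setIC H sb -H setIC.
Qed.

Canonical germ_equiv := EquivRel germ_eqb germ_eqb_refl germ_eqb_sym germ_eqb_trans.

(* [germ_section_continuous], [germ_section_open], [germ_src_continuous] and
   [germ_sectionK] below say that the quotient topology is the one in which the
   image of each {s} x Omega(s^-1 s) is open and mapped homeomorphically onto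
   Omega(s^-1 s) by the source map. *)
Definition germs : topologicalType :=
  quotient_topology {eq_quot germ_equiv}%qT.

Definition germ (p : germ_pair) : germs := \pi_germs%qT p.

Definition germ_section (s : Il C) (chi : OmegaDom s) : germs :=
  germ (existT _ s chi).

(* the source map [s, chi] |-> chi *)
Definition germ_src (g : germs) : Omega C := pair_src (repr g).

Lemma germP (p q : germ_pair) : germ p = germ q <-> germ_eq p q.
Proof.
have H := @eqmodP _ germ_equiv p q.
by split=> [/H/asboolP|h] //; apply/H/asboolP.
Qed.

Lemma germ_srcE (p : germ_pair) : germ_src (germ p) = pair_src p.
Proof.
have /germP[//] : germ (repr (germ p)) = germ p by exact: reprK.
Qed.

Lemma germ_sectionK (s : Il C) (chi : OmegaDom s) :
  germ_src (germ_section chi) = \val chi.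
Proof. by rewrite /germ_section germ_srcE. Qed.

Lemma germ_src_continuous : continuous germ_src.
Proof.
apply/quotient_continuous.
have -> : germ_src \o \pi_germs%qT = pair_src.
  by apply/funext => p; exact: germ_srcE.
apply: (@sigT_continuous _ OmegaDom (Omega C) (fun s chi => \val chi)) => s.
exact: initial_continuous.
Qed.

Lemma germ_section_continuous (s : Il C) : continuous (@germ_section s).
Proof.
move=> chi; apply: (@continuous_comp (OmegaDom s) germ_pair germs
  (existT _ s) germ).
  exact: existT_continuous.
exact: pi_continuous.
Qed.

Lemma germ_section_open (s : Il C) (U : set (OmegaDom s)) :
  open U -> open (@germ_section s @` U).
Proof.
move=> [V oV VU]; apply/sigT_openP => t.
pose W := [set chi : Omega C | \val chi (Jdom s) = true] `&` V `&`
  \bigcup_(eps in [set eps | prestr (\val s) eps = prestr (\val t) eps])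
    [set chi | P chi eps].
exists W.
  apply: openI; last by apply: bigcup_open => eps _; exact: gs_open.
  by apply: openI => //; exact: open_eval.
apply/seteqP; split=> chi.
  move=> [[hs hV] [eps hst hP]].
  exists (exist _ (\val chi) (mem_set hs)); first by rewrite -VU.
  by apply/germP; split=> //; exists eps.
move=> [chi' Uchi' /germP[h [eps hP hst]]].
have {}h : \val chi' = \val chi := h.
move: Uchi'; rewrite -VU => Vchi'; suff : W (\val chi') by rewrite h.
by split; [split=> //; exact: (set_valP chi')|exists eps].
Qed.

End Germs.

(* The topological spaces underlying I_l |x Omega and I_l |x-bar Omega; being
   Hausdorff does not involve the groupoid operations, which are not defined. *)
Definition transformation_groupoid (C : lcCategory) : topologicalType :=
  germs (GermSupports (@supp_dom C) (@suppI C) (@supp_open C)).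

Definition transformation_groupoid_bar (C : lcCategory) : topologicalType :=
  germs (GermSupports (@supp_bar_dom C) (@supp_barI C) (@supp_bar_open C)).

(* Main.v *)
Require Import Defs.
From mathcomp Require Import all_boot finmap.
From mathcomp Require Import all_classical.
From mathcomp Require Import topology.
(* Makes [pinv] and [pcomp] denote the operations on partial maps again. *)
Import Defs.
Local Open Scope classical_set_scope.

(** Two germs [[s, chi]] and [[t, chi]] agree exactly when some set on which [s]
    and [t] coincide lies in the support of [chi], and the set of points of
    both domains where [s] and [t] take the same value is the fixed-point set
    of [s^-1 t].  So everything depends on how fixed-point sets are built from
    sets in [J], resp. [Jbar].  Both groupoids are treated at once: the
    supports of a character only need to behave like an ultrafilter in a family
    [K] of sets ([ultrafilter_supports]), that is, depend on the character in a
    clopen way and be prime for finite unions.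

    If all fixed-point sets are finite unions of sets in [K], take distinct
    germs of [s] and [t] at [chi] and write the fixed-point set of [s^-1 t] as
    the union of a finite family [E].  No member of [E] is in the support of
    [chi]; this persists on a neighbourhood [N] of [chi] by clopenness, and by
    primality [s] and [t] have distinct germs at every point of [N] where both
    are defined.  Hence the images of [N] under the two sections separate the
    germs ([pfix_hausdorff]).  Germs at different characters are separated by
    their sources.

    Conversely, if germs are separated, the characters at which [s] and the
    identity of its domain have the same germ form a closed set
    ([closed_agree]) inside the set of characters with value 1 at the domain of
    [s], which is compact ([compact_eval]).  It is covered by the open sets of
    characters having in their support a given set in [K] fixed by [s], so
    finitely many such sets suffice.  Their union is the whole fixed-point set:
    a morphism [x] gives the character [principal x] of all sets containing
    [x], and if [s] fixes [x], then it fixes the right ideal generated by [x],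
    which is in [J] ([pfix_nbhs]); so [principal x] belongs to the closed set,
    and one of the finitely many sets is in its support, hence contains [x]
    ([hausdorff_pfix]). *)

(** * The left inverse hull acts by maps of right ideals *)

Lemma Il_src (C : lcCategory) (s : set (C * C)) (x y : C) :
  Il C s -> s (x, y) -> src x = src y.
Proof.
move=> sI; elim: sI x y => {s} [c|s t _ IHs _ IHt|s _ IHs] x y /=.
- by move=> [a /= ca [<- <-]]; rewrite src_cmp.
- by move=> [z /IHt -> /IHs].
- by move=> /IHs ->.
Qed.

(** Left multiplication commutes with right multiplication, so every element
    of the hull is a morphism of right ideals. *)
Lemma Il_cmp (C : lcCategory) (s : set (C * C)) (x y c : C) :
  Il C s -> s (x, y) -> src x = tgt c -> s (cmp x c, cmp y c).
Proof.
move=> sI; elim: sI x y => {s} [a|s t _ IHs tI IHt|s sI IHs] x y.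
- move=> [z /= az [<- <-]] zc; exists (cmp z c); first by rewrite /= tgt_cmp.
  by rewrite cmpA.
- move=> [z /= xz zy] xc; exists (cmp z c); first exact: IHt.
  by apply: IHs => //; rewrite -(Il_src _ _ _ _ tI xz).
- by move=> /= yx xc; apply: IHs => //; rewrite (Il_src _ _ _ _ sI yx).
Qed.

Lemma Il_pdom (C : lcCategory) (s : set (C * C)) :
  Il C s -> exists e : J C, \val e = pdom s.
Proof.
by move=> sI; exists (Jdom (exist _ s (mem_set sI))).
Qed.

(** The right ideal generated by a fixed point [x] is fixed by equivariance, and
    it lies in [J C] as the domain of the inverse of multiplication by [x]. *)
Lemma pfix_nbhs (C : lcCategory) (s : set (C * C)) (x : C) :
  Il C s -> pfix s x -> exists e : J C, \val e x /\ \val e `<=` pfix s.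
Proof.
move=> sI sx; have [e eE] := Il_pdom _ _ (lih_inv (lih_gen x)).
exists e; rewrite eE; split.
  by exists (src x), (src x); rewrite /= ?tgt_src ?cmp_src.
by move=> _ [_ [c /= xc [_ <-]]]; apply: Il_cmp.
Qed.

(** * Compactness in the space of characters *)

(** Near-covering compactness for the filter of eventually large finite
    subfamilies. *)
Lemma compact_finite_subcover {T : topologicalType} {I : Type} {A : set T}
    {D : set I} {f : I -> set T} :
  compact A -> (forall i, D i -> open (f i)) -> A `<=` \bigcup_(i in D) f i ->
  exists E : set I, [/\ finite_set E, E `<=` D & A `<=` \bigcup_(i in E) f i].
Proof.
move=> /compact_near_coveringP ncA fop AD.
pose fin := [set E : set I | finite_set E /\ E `<=` D].
pose F := filter_from fin (fun E => [set E' | E `<=` E' /\ E' `<=` D]).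
have FF : Filter F.
  apply: filter_from_filter; first by exists set0; split.
  move=> E E' [finE ED] [finE' ED']; exists (E `|` E').
    by split; [rewrite finite_setU|rewrite subUset].
  by move=> G [+ GD]; rewrite subUset => -[EG E'G]; split; split.
have [|E [finE ED] AE] := ncA _ F (fun E x => (\bigcup_(i in E) f i) x) FF.
  move=> x /AD[i Di fx]; exists (f i, [set E | E i /\ E `<=` D]) => /=.
    split; first by apply: open_nbhs_nbhs; split=> //; exact: fop.
    exists [set i]; first by split; [exact: finite_set1|move=> _ ->].
    by move=> E [iE ED]; split=> //; exact: iE.
  by move=> [y E] [/= fiy [Ei _]]; exists i.
by exists E; split=> //; apply: AE; split=> //.
Qed.

Section Characters.
Context {C : lcCategory}.
Implicit Types (chi : Omega C) (e : J C) (x : C).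

Definition principal_fun x : {ptws J C -> bool} := fun e => `[< \val e x >].

Lemma principal_fun_Omega x : Omega C (principal_fun x).
Proof.
split; [split|].
- have [e eE] := Il_pdom _ _ (lih_gen (tgt x)).
  exists e; apply/asboolP; rewrite eE.
  by exists (cmp (tgt x) x), x => //=; rewrite src_tgt.
- by move=> e f; rewrite /principal_fun asbool_and.
- by move=> e e0; apply/asboolP; rewrite e0.
- move=> e F _ eF /asboolP; rewrite eF => -[f Ff fx].
  by exists f => //; apply/asboolP.
Qed.

Definition principal x : Omega C :=
  exist _ (principal_fun x) (mem_set (principal_fun_Omega x)).

Lemma principalE x e : \val (principal x) e = true <-> \val e x.
Proof. by split=> [/asboolP|?]; last exact/asboolP. Qed.

Lemma Omega_cover {chi e} (F : set (J C)) : finite_set F ->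
  \val e `<=` \bigcup_(f in F) \val f -> \val chi e = true ->
  exists2 f, F f & \val chi f = true.
Proof.
move=> finF eF chie; have [_ cov] := set_valP chi.
have [||_ [f Ff <-]] := cov e (Jmeet e @` F) _ _ chie.
- exact: finite_image.
- apply/seteqP; split=> y; last by move=> [_ [f _ <-]] [].
  by move=> ey; have [f Ff fy] := eF y ey; exists (Jmeet e f) => //; exists f.
- by rewrite OmegaI => /andP[_ chif]; exists f.
Qed.

(** An ultrafilter on characters decides the value at each [e]; the resulting
    function is a character because each defining condition involves finitely
    many values, which are realised by a single character.  The exception is
    that a character must not vanish identically, whence the hypothesis. *)
Lemma Omega_limit (F : set_system (Omega C)) (UF : UltraFilter F) :
  (exists e, F [set chi | \val chi e = true]) -> exists chi, F --> chi.
Proof.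
move=> [e0 Fe0].
pose lim : {ptws J C -> bool} :=
  fun e => `[< F [set chi | \val chi e = true] >].
have Flim e : F [set chi | \val chi e = lim e].
  rewrite /lim; case: asboolP => // nF.
  have [//|] := in_ultra_setVsetC [set chi | \val chi e = true] UF.
  by apply: filterS => chi /= /negP/negbTE.
have limO : Omega C lim.
  split; [split|].
  - by exists e0; apply/asboolP.
  - move=> e f; have [chi [[/= <- <-] <-]] := filter_ex
      (filterI (filterI (Flim e) (Flim f)) (Flim (Jmeet e f))).
    exact: OmegaI.
  - move=> e e_0; have [chi /= <-] := filter_ex (Flim e).
    by have [[_ _ chi0] _] := set_valP chi; exact: chi0.
  - move=> e G /finite_fsetP[D ->] eD lime; apply: contrapT => nG.
    have : F (\bigcap_(f in [set` D]) [set chi | \val chi f = lim f]).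
      by apply: filter_bigI.
    move=> /(filterI (Flim e)) /filter_ex[chi [/= chie chiD]].
    have [f Df chif] : exists2 f, [set` D] f & \val chi f = true.
      apply: (Omega_cover _ (finite_fset D) _ (etrans chie lime)).
      by rewrite eD.
    by apply: nG; exists f => //; rewrite -chiD.
exists (exist _ lim (mem_set limO)) => A.
move=> [_ [[V oV <-] Vlim VA]]; apply: filterS VA _.
have FF : Filter (\val @ F) by exact: fmap_filter.
suff : \val @ F --> lim by apply; exact: open_nbhs_nbhs.
apply/cvg_sup => e B [_ [[W oW <-] Wlim WB]].
apply: (@filterS _ F _ _ _ _ (Flim e)) => chi /= chie.
by apply: WB; rewrite /= chie.
Qed.

Lemma compact_eval e : compact [set chi : Omega C | \val chi e = true].
Proof.
rewrite compact_ultra => F UF Fe.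
have [chi Fchi] := Omega_limit F UF (ex_intro _ e Fe).
exists chi; split=> //=; case E: (\val chi e) => //.
have /filterI/(_ Fe)/filter_ex[psi [/=]] : F [set psi | \val psi e = false].
  apply: Fchi; apply: open_nbhs_nbhs; split=> //; exact: open_eval.
by move=> ->.
Qed.

Lemma closed_eval e b : closed [set chi : Omega C | \val chi e = b].
Proof.
have -> : [set chi : Omega C | \val chi e = b] =
    ~` [set chi : Omega C | \val chi e = ~~ b].
  by apply/seteqP; split=> chi /=; case: (\val chi e); case: b.
exact/open_closedC/open_eval.
Qed.

End Characters.

(** * Supports of a character as ultrafilters *)

Section Supports.
Context {C : lcCategory}.
Implicit Types (chi : Omega C) (a eps : set C).

Lemma J_Jbar : J C `<=` Jbar C.
Proof.
move=> a Ja; exists (exist _ a (mem_set Ja)), set0.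
by split=> //; rewrite bigcup_set0 setD0.
Qed.

Lemma supp_bar_Jbar chi eps : supp_bar chi eps -> Jbar C eps.
Proof. by move=> [e [F [eF _]]]; exists e, F. Qed.

Lemma supp_J chi a : supp chi a -> J C a.
Proof. by move=> [e _ <-]; exact: set_valP. Qed.

Lemma supp_supp_bar chi a : supp chi a -> supp_bar chi a.
Proof. by move=> [e ? <-]; exact: supp_bar_dom. Qed.

(** A set in [J C] presents itself with nothing removed, and evaluation does
    not depend on the presentation. *)
Lemma supp_barE chi a : J C a -> supp_bar chi a = supp chi a.
Proof.
move=> Ja; apply/propext; split; last exact: supp_supp_bar.
move=> [e [F [eF chieF]]]; pose f : J C := exist _ a (mem_set Ja).
have pf : presents f set0 a by split=> //; rewrite bigcup_set0 setD0.
by exists f => //; have [] := eval_presented_indep eF pf chieF.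
Qed.

Lemma supp_bar_nonempty chi : ~ supp_bar chi set0.
Proof.
move=> [e [F [[finF _ e0] [chie chiF]]]].
have [|f Ff] := Omega_cover F finF _ chie; last by rewrite chiF.
by rewrite -setD_eq0.
Qed.

(** Write [eps] as [e] minus the union of [F].  If [chi] vanishes at [e], remove
    [e] from [a]; otherwise [chi] is 1 at some [f] in [F], and [a] is cut down to
    its part in [f]. *)
Lemma supp_bar_avoid chi a eps : Jbar C eps -> supp_bar chi a ->
  ~ supp_bar chi eps -> exists2 b, supp_bar chi b & b `<=` a `\` eps.
Proof.
move=> [e [F eF]] chia nchi; have [_ _ epsE] := eF.
case chie: (\val chi e); last first.
  have [d [G [[finG Gd ->] [chid chiG]]]] := chia.
  exists (\val d `\` \bigcup_(f in Jmeet d e |` G) \val f).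
    exists d, (Jmeet d e |` G); split; split=> //.
    - by rewrite finite_setU; split=> //; exact: finite_set1.
    - by move=> _ [->|/Gd//] x [].
    - by move=> _ [->|/chiG//]; rewrite OmegaI chie andbF.
  move=> x [dx nx]; split.
    by split=> // -[f Gf fx]; apply: nx; exists f => //; right.
  by rewrite epsE => -[ex _]; apply: nx; exists (Jmeet d e) => //; left.
have [f Ff chif] : exists2 f, F f & \val chi f = true.
  apply: contrapT => nF; apply: nchi; exists e, F; split=> //; split=> // f Ff.
  by apply/negbTE/negP => chif; apply: nF; exists f.
exists (a `&` \val f); first by apply: supp_barI => //; exact: supp_bar_dom.
by move=> x [ax fx]; split=> //; rewrite epsE => -[_]; apply; exists f.
Qed.

(** If no member of the cover were in the support, [a] could be shrunk inside
    the support to avoid them all, hence to the empty set. *)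
Lemma supp_bar_prime chi a (E : set (set C)) : finite_set E -> E `<=` Jbar C ->
  supp_bar chi a -> a `<=` \bigcup_(eps in E) eps ->
  exists2 eps, E eps & supp_bar chi eps.
Proof.
move=> /finite_seqP[l ->] lJ chia al; apply: contrapT => nl.
suff [b chib] : exists2 b, supp_bar chi b &
    b `<=` a `\` \bigcup_(eps in [set` l]) eps.
  have -> : a `\` \bigcup_(eps in [set` l]) eps = set0 by rewrite setD_eq0.
  by rewrite subset0 => b0; move: chib; rewrite b0; exact: supp_bar_nonempty.
elim: l lJ nl {al} => [|eps l IHl] lJ nl.
  by exists a => // x ax; split=> // -[].
have [||b chib bl] := IHl.
- by move=> d /= dl; apply: lJ; rewrite /= inE dl orbT.
- move=> [d dl chid]; apply: nl; exists d => //.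
  by rewrite /= inE [d \in l]dl orbT.
have [||d chid db] := supp_bar_avoid chi b eps _ chib.
- by apply: lJ; rewrite /= mem_head.
- by move=> chieps; apply: nl; exists eps => //; rewrite /= mem_head.
exists d => // x /db[/bl[ax nlx] nx]; split=> // -[f].
by rewrite /= inE => /orP[/eqP ->//|fl] fx; apply: nlx; exists f.
Qed.

Lemma closed_supp_bar eps : Jbar C eps -> closed [set chi | supp_bar chi eps].
Proof.
move=> [e [F eF]].
have -> : [set chi | supp_bar chi eps] = [set chi : Omega C | \val chi e = true]
    `&` \bigcap_(f in F) [set chi : Omega C | \val chi f = false].
  apply/seteqP; split=> chi.
    move=> [e' [F' [eF' chieF']]].
    by have [] := eval_presented_indep eF' eF chieF'.
  by move=> [chie chiF]; exists e, F.
by apply: closedI; [|apply: closed_bigI => f _]; exact: closed_eval.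
Qed.

Lemma supp_bar_principal x eps : supp_bar (principal x) eps -> eps x.
Proof.
move=> [e [F [[_ _ ->] [/principalE ex xF]]]]; split=> // -[f Ff /principalE].
by rewrite xF.
Qed.

End Supports.

(** What the criterion uses of [supp] with [J C] and of [supp_bar] with
    [Jbar C]. *)
Record ultrafilter_supports {C : lcCategory} (P : germ_supports C)
    (K : set (set C)) : Prop := UltrafilterSupports {
  us_class : forall chi a, P chi a -> K a;
  us_closed : forall a, K a -> closed [set chi | P chi a];
  us_prime : forall chi a (E : set (set C)), finite_set E -> E `<=` K ->
    P chi a -> a `<=` \bigcup_(e in E) e -> exists2 e, E e & P chi e;
  us_principal : forall x a, P (principal x) a -> a x
}.

(** * The Hausdorff criterion *)

Section Criterion.
Context {C : lcCategory} {P : germ_supports C}.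

Lemma germ_section_nbhs {s : Il C} {chi : OmegaDom s} {A : set (germs P)} :
  open A -> A (germ_section P chi) ->
  exists2 W : set (Omega C), nbhs (\val chi) W &
    forall psi : OmegaDom s, W (\val psi) -> A (germ_section P psi).
Proof.
move=> oA Achi.
have [V oV VA] : open (@germ_section C P s @^-1` A).
  by apply: open_comp => // psi _; exact: germ_section_continuous.
have VE (psi : OmegaDom s) : V (\val psi) = A (germ_section P psi).
  by rewrite -[LHS]/((\val @^-1` V) psi) VA.
exists V; first by apply: open_nbhs_nbhs; split=> //; rewrite VE.
by move=> psi; rewrite VE.
Qed.

(** The equalizer of two continuous sections into a Hausdorff space is closed in
    their common domain, and that domain is closed in [Omega C]. *)
Lemma closed_agree {s t : Il C} : Jdom s = Jdom t ->
  hausdorff_space (germs P) ->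
  closed [set chi : Omega C | \val chi (Jdom s) = true /\
    exists2 a, P chi a & prestr (\val s) a = prestr (\val t) a].
Proof.
move=> st hG chi clchi.
have chis : \val chi (Jdom s) = true.
  by apply: (closed_eval (Jdom s) true) => B /clchi[psi [[? _] ?]]; exists psi.
have chit : \val chi (Jdom t) = true by rewrite -st.
pose chi_s : OmegaDom s := exist _ chi (mem_set chis).
pose chi_t : OmegaDom t := exist _ chi (mem_set chit).
have [/germP[_ ?]//|] := pselect (germ_section P chi_s = germ_section P chi_t).
move=> /eqP; move: hG; rewrite open_hausdorff => /[apply].
move=> [[A B] /= [/set_mem As /set_mem Bt] [oA oB /eqP AB0]].
have [V nV VA] := germ_section_nbhs oA As.
have [W nW WB] := germ_section_nbhs oB Bt.
have [psi [[psis [a Pa sta]] [Vpsi Wpsi]]] := clchi _ (filterI nV nW).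
have psit : \val psi (Jdom t) = true by rewrite -st.
have Apsi := VA (exist _ psi (mem_set psis)) Vpsi.
have Bpsi := WB (exist _ psi (mem_set psit)) Wpsi.
suff E : germ_section P (exist _ psi (mem_set psis) : OmegaDom s) =
         germ_section P (exist _ psi (mem_set psit) : OmegaDom t).
  have : (A `&` B) (germ_section P (exist _ psi (mem_set psis) : OmegaDom s)).
    by split=> //; rewrite E.
  by rewrite AB0.
by apply/germP; split=> //; exists a.
Qed.

Lemma hausdorff_pfix {K : set (set C)} {s : set (C * C)} :
  ultrafilter_supports P K -> hausdorff_space (germs P) -> Il C s ->
  exists E : set (set C),
    [/\ finite_set E, E `<=` K & pfix s = \bigcup_(e in E) e].
Proof.
move=> us hG sI; have [sf si] := Il_partial_bijection sI.
have idI : Il C (pcomp (pinv s) s) by apply: lih_comp => //; exact: lih_inv.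
pose s' : Il C := exist _ s (mem_set sI).
pose i' : Il C := exist _ (pcomp (pinv s) s) (mem_set idI).
have idE x y : pcomp (pinv s) s (x, y) <-> x = y /\ pdom s x.
  split=> [[z /= xz yz]|[<- [z xz]]]; last by exists z.
  by split; [exact: si xz yz|exists z].
have agree a : prestr s a = prestr (pcomp (pinv s) s) a <->
    a `&` pdom s `<=` pfix s.
  split=> [E x [ax [y xy]]|sub].
    have : prestr s a (x, y) by [].
    by rewrite E => -[/idE[xy' _] _]; move: xy; rewrite -xy'.
  apply/seteqP; split=> -[x y] /= [].
    move=> /= xy ax; split=> //; apply/idE.
    have dx : pdom s x by exists y.
    by split=> //; exact: sf (sub x (conj ax dx)) xy.
  by move=> /idE[<- dx] ax; split=> //=; apply: sub.
have dE : Jdom s' = Jdom i'.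
  apply: val_inj; apply/seteqP; split=> x /=.
    by move=> dx; exists x; apply/idE.
  by move=> [y /idE[]].
set U := [set chi : Omega C | \val chi (Jdom s') = true /\
  exists2 a, P chi a & prestr s a = prestr (pcomp (pinv s) s) a].
have compactU : compact U.
  apply: subclosed_compact (compact_eval (Jdom s')) _; last by move=> chi [].
  exact: (closed_agree dE hG).
have [||D [finD DK UD]] := compact_finite_subcover compactU
    (D := [set a | K a /\ a `<=` pfix s]) (f := fun a => [set chi | P chi a]).
- by move=> a _; exact: gs_open.
(* [s] fixes only the part of [a] in its domain, so [a] is cut down to it. *)
- move=> chi [chis [a Pa /agree sub]]; have Pad := gs_I Pa (gs_dom P chis).
  by exists (a `&` pdom s) => //; split=> //; exact: us_class us _ _ Pad.
exists D; split=> //; first by move=> a /DK[].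
apply/seteqP; split=> x; last by move=> [a /DK[_ sub] /sub].
move=> sx; have [e [ex es]] := pfix_nbhs _ _ _ sI sx.
have [|a Da Pa] := UD (principal x); last first.
  by exists a => //; exact: us_principal us _ _ Pa.
split; first by apply/principalE; exists x.
exists (\val e); first by apply: gs_dom; apply/principalE.
by apply/agree => y [/es].
Qed.

Lemma pfix_hausdorff {K : set (set C)} : ultrafilter_supports P K ->
  (forall s : set (C * C), Il C s -> exists E : set (set C),
    [/\ finite_set E, E `<=` K & pfix s = \bigcup_(e in E) e]) ->
  hausdorff_space (germs P).
Proof.
move=> us fixE; rewrite open_hausdorff => g h.
rewrite -[g]reprK -[h]reprK -!/(germ _).
case: (repr g) (repr h) => [s chi] [t psi] {g h} /eqP gh.
have [chipsi|] := pselect (\val chi = \val psi); last first.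
  move=> chipsi.
  have [e echi] : exists e, \val (\val chi) e <> \val (\val psi) e.
    by apply/existsNP => eq; apply: chipsi; apply: val_inj; apply/funext.
  pose A b := @germ_src C P @^-1` [set xi : Omega C | \val xi e = b].
  have oA b : open (A b).
    apply: open_comp (open_eval e b) => // x _; exact: germ_src_continuous.
  exists (A (\val (\val chi) e), A (\val (\val psi) e)) => /=.
    by split; apply/mem_set; rewrite /A /= germ_srcE.
  split=> //; apply/eqP/seteqP; split=> // x [xchi xpsi].
  by apply: echi; exact: etrans (esym xchi) xpsi.
have [E [finE EK EE]] := fixE _ (lih_comp (lih_inv (set_valP s)) (set_valP t)).
have sE x : (exists2 y, (\val t) (x, y) & (\val s) (x, y)) <->
    (\bigcup_(a in E) a) x by rewrite -EE.
have [sf _] := Il_partial_bijection (set_valP s).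
have [tf _] := Il_partial_bijection (set_valP t).
(* At the characters in [N], the germs of [s] and [t] differ, by primality. *)
pose N := ~` \bigcup_(a in E) [set xi : Omega C | P xi a].
have oN : open N.
  by apply/closed_openC/closed_bigcup => // a /EK; exact: us_closed.
pose img (r : Il C) := @germ_section C P r @` (\val @^-1` N).
have oimg r : open (img r).
  apply: germ_section_open; apply: open_comp => // x _.
  exact: initial_continuous.
have Nchi : N (\val chi).
  move=> [a Ea Pa]; apply: gh; apply/germP; split=> //=; exists a => //.
  have sub x : a x -> exists2 y, (\val t) (x, y) & (\val s) (x, y).
    by move=> ax; apply/sE; exists a.
  apply/seteqP; split=> -[x y] /= [/= xy ax]; split=> //=;
    have [z tz sz] := sub x ax.
    by rewrite (sf _ _ _ xy sz).
  by rewrite (tf _ _ _ xy tz).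
exists (img s, img t) => /=.
  split; apply/mem_set; first by exists chi.
  by exists psi => //; rewrite /= -chipsi.
split=> //; apply/eqP/seteqP; split=> // _ [[xi Nxi <-] [zeta _ /germP[zx]]].
move=> [a Pa ta]; apply: Nxi; have {}zx : \val zeta = \val xi := zx.
have {}Pa : P (\val zeta) a := Pa; rewrite zx in Pa.
have {}Pa := gs_I Pa (gs_dom P (set_valP xi)).
apply: us_prime us _ _ _ finE EK Pa _ => x [ax [y xy]].
apply/sE; exists y => //.
have : prestr (\val s) a (x, y) by [].
by rewrite -ta => -[].
Qed.

Lemma hausdorff_germs_iff {K : set (set C)} : ultrafilter_supports P K ->
  hausdorff_space (germs P) <->
  forall s : set (C * C), Il C s -> exists E : set (set C),
    [/\ finite_set E, E `<=` K & pfix s = \bigcup_(e in E) e].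
Proof.
move=> us; split; first by move=> hG s; exact: hausdorff_pfix us hG.
exact: pfix_hausdorff us.
Qed.

End Criterion.

Lemma ultrafilter_supports_supp (C : lcCategory) : ultrafilter_supports
  (GermSupports (@supp_dom C) (@suppI C) (@supp_open C)) (J C).
Proof.
split=> /=.
- exact: supp_J.
- move=> a Ja; rewrite (_ : [set _ | _] = [set chi | supp_bar chi a]).
    exact/closed_supp_bar/J_Jbar.
  by apply/funext => chi; exact/esym/supp_barE.
- move=> chi a E finE EJ /supp_supp_bar chia aE.
  have EJbar : E `<=` Jbar C by move=> e /EJ/J_Jbar.
  have [e Ee che] := supp_bar_prime _ _ _ finE EJbar chia aE.
  by exists e => //; rewrite -supp_barE //; exact: EJ.
- by move=> x a /supp_supp_bar; exact: supp_bar_principal.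
Qed.

Lemma ultrafilter_supports_supp_bar (C : lcCategory) : ultrafilter_supports
  (GermSupports (@supp_bar_dom C) (@supp_barI C) (@supp_bar_open C)) (Jbar C).
Proof.
split=> /=.
- exact: supp_bar_Jbar.
- exact: closed_supp_bar.
- by move=> chi a E; exact: supp_bar_prime.
- exact: supp_bar_principal.
Qed.

Theorem lemma4p1 (C : lcCategory) :
  (hausdorff_space (transformation_groupoid C) <->
     forall s : set (C * C), Il C s ->
       exists E : set (set C),
         [/\ finite_set E, E `<=` J C & pfix s = \bigcup_(e in E) e]) /\
  (hausdorff_space (transformation_groupoid_bar C) <->
     forall s : set (C * C), Il C s ->
       exists E : set (set C),
         [/\ finite_set E, E `<=` Jbar C & pfix s = \bigcup_(eps in E) eps]).
Proof.
split; apply: hausdorff_germs_iff.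
  exact: ultrafilter_supports_supp.
exact: ultrafilter_supports_supp_bar.
Qed.
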